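(* For all $\Sigma\cup\{\alpha\}\subseteq\mathit{Fm}$, if $\Sigma\vdash_{\mathrm{HIPWK}}\alpha$, then $\Sigma\models_{\mathrm{IPWK}}\alpha$.
   Context: Formulas $\mathit{Fm}$ are built over a countably infinite set $V$ of variables in the language $\mathcal{L}=\{\land,\lor,\longrightarrow,\neg,0,1\}$. $\mathrm{var}(\varphi)$ is the set of variables in $\varphi$. HIPWK is the Hilbert-style logic (derivations from hypotheses $\Sigma$ as finite sequences of axiom instances, hypotheses, and rule applications) with axiom schemes (A1) $\alpha\longrightarrow(\beta\longrightarrow\alpha)$; (A2) $(\alpha\longrightarrow(\beta\longrightarrow\gamma))\longrightarrow((\alpha\longrightarrow\beta)\longrightarrow(\alpha\longrightarrow\gamma))$; (A3) $\alpha\longrightarrow(\beta\longrightarrow(\alpha\land\beta))$; (A4) $\alpha\land\beta\longrightarrow\alpha$; (A5) $\alpha\land\beta\longrightarrow\beta$; (A6) $\alpha\longrightarrow\alpha\lor\beta$; (A7) $\beta\longrightarrow\alpha\lor\beta$; (A8) $(\alpha\longrightarrow\gamma)\longrightarrow((\beta\longrightarrow\gamma)\longrightarrow(\alpha\lor\beta\longrightarrow\gamma))$; (A9) $(\alpha\longrightarrow\beta)\longrightarrow((\alpha\longrightarrow\neg\beta)\longrightarrow\neg\alpha)$; (A10) $0\longrightarrow\alpha$, and the single rule $\frac{\alpha,\ \alpha\longrightarrow\beta}{\beta}$ provided $\mathrm{var}(\alpha)\subseteq\mathrm{var}(\beta)$. For a Heyting algebra $\mathbf{H}$ (as an $\mathcal{L}$-algebra,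 universe $H$), $\mathbf{H}^\#$ has universe $H\cup\{\omega\}$ ($\omega\notin H$), constants as in $\mathbf{H}$, and each operation of arity $\ge1$ agrees with $\mathbf{H}$ on arguments in $H$ and returns $\omega$ if some argument is $\omega$. $\Sigma\models_{\mathrm{IPWK}}\alpha$ iff for every Heyting algebra $\mathbf{H}$ and every homomorphism $v^\#:\mathbf{Fm}\to\mathbf{H}^\#$, $v^\#[\Sigma]\subseteq\{1,\omega\}$ implies $v^\#(\alpha)\in\{1,\omega\}$. *)

(* Defs.v *)
From Stdlib Require Import List Ensembles.
Import ListNotations.

(** Variables are indexed by [nat], a countably infinite set. *)
Inductive formula : Type :=
| Var (x : nat)
| And (a b : formula)
| Or (a b : formula)
| Imp (a b : formula)
| Neg (a : formula)
| Zero
| One.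

Declare Scope formula_scope.
Delimit Scope formula_scope with F.
Bind Scope formula_scope with formula.
Infix "⊓" := And (at level 40, left associativity) : formula_scope.
Infix "⊔" := Or (at level 50, left associativity) : formula_scope.
Infix "⟶" := Imp (at level 60, right associativity) : formula_scope.
Notation "∼ a" := (Neg a) (at level 35, right associativity) : formula_scope.

Fixpoint var (phi : formula) : Ensemble nat :=
  match phi with
  | Var x => Singleton nat x
  | And a b | Or a b | Imp a b => Union nat (var a) (var b)
  | Neg a => var a
  | Zero | One => Empty_set nat
  end.

Inductive HIPWK_axiom : formula -> Prop :=
| A1 a b : HIPWK_axiom (a ⟶ b ⟶ a)
| A2 a b c : HIPWK_axiom ((a ⟶ b ⟶ c) ⟶ (a ⟶ b) ⟶ a ⟶ c)
| A3 a b : HIPWK_axiom (a ⟶ b ⟶ a ⊓ b)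
| A4 a b : HIPWK_axiom (a ⊓ b ⟶ a)
| A5 a b : HIPWK_axiom (a ⊓ b ⟶ b)
| A6 a b : HIPWK_axiom (a ⟶ a ⊔ b)
| A7 a b : HIPWK_axiom (b ⟶ a ⊔ b)
| A8 a b c : HIPWK_axiom ((a ⟶ c) ⟶ (b ⟶ c) ⟶ a ⊔ b ⟶ c)
| A9 a b : HIPWK_axiom ((a ⟶ b) ⟶ (a ⟶ ∼ b) ⟶ ∼ a)
| A10 a : HIPWK_axiom (Zero ⟶ a).

Definition HIPWK_rule (premise1 premise2 conclusion : formula) : Prop :=
  premise2 = (premise1 ⟶ conclusion)%F /\
  Included nat (var premise1) (var conclusion).

Definition HIPWK_derivation (Sigma : Ensemble formula) (s : list formula) : Prop :=
  forall n phi, nth_error s n = Some phi ->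
    HIPWK_axiom phi \/
    In formula Sigma phi \/
    exists i j a b, i < n /\ j < n /\
      nth_error s i = Some a /\ nth_error s j = Some b /\ HIPWK_rule a b phi.

Definition HIPWK_derives (Sigma : Ensemble formula) (alpha : formula) : Prop :=
  exists s : list formula, HIPWK_derivation Sigma (s ++ [alpha]).

Record algebra : Type := Algebra {
  carrier :> Type;
  meet : carrier -> carrier -> carrier;
  join : carrier -> carrier -> carrier;
  imp : carrier -> carrier -> carrier;
  neg : carrier -> carrier;
  zero : carrier;
  one : carrier
}.

Arguments meet {_} _ _.
Arguments join {_} _ _.
Arguments imp {_} _ _.
Arguments neg {_} _.
Arguments zero {_}.
Arguments one {_}.

Definition Fm : algebra := Algebra formula And Or Imp Neg Zero One.

Record homomorphism (A B : algebra) (h : A -> B) : Prop := {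
  hom_meet : forall x y, h (meet x y) = meet (h x) (h y);
  hom_join : forall x y, h (join x y) = join (h x) (h y);
  hom_imp : forall x y, h (imp x y) = imp (h x) (h y);
  hom_neg : forall x, h (neg x) = neg (h x);
  hom_zero : h zero = zero;
  hom_one : h one = one
}.

Definition le {A : algebra} (x y : A) : Prop := meet x y = x.

(** The degenerate algebra, in which [zero = one], is not excluded. *)
Record heyting (H : algebra) : Prop := {
  meetC : forall x y : H, meet x y = meet y x;
  meetA : forall x y z : H, meet x (meet y z) = meet (meet x y) z;
  joinC : forall x y : H, join x y = join y x;
  joinA : forall x y z : H, join x (join y z) = join (join x y) z;
  meetKjoin : forall x y : H, meet x (join x y) = x;
  joinKmeet : forall x y : H, join x (meet x y) = x;
  le_zero : forall x : H, le zero x;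
  le_one : forall x : H, le x one;
  residuation : forall x y z : H, le (meet x y) z <-> le x (imp y z);
  negE : forall x : H, neg x = imp x zero
}.

Definition lift1 {T : Type} (f : T -> T) (x : option T) : option T :=
  match x with
  | Some a => Some (f a)
  | None => None
  end.

Definition lift2 {T : Type} (f : T -> T -> T) (x y : option T) : option T :=
  match x, y with
  | Some a, Some b => Some (f a b)
  | _, _ => None
  end.

(** H^#, with [None] as the absorbing element omega. *)
Definition sharp (H : algebra) : algebra :=
  Algebra (option H) (lift2 meet) (lift2 join) (lift2 imp) (lift1 neg)
    (Some zero) (Some one).

Definition omega {H : algebra} : sharp H := None.

Definition designated (H : algebra) : Ensemble (sharp H) :=
  Couple (sharp H) one omega.

Definition IPWK_entails (Sigma : Ensemble formula) (alpha : formula) : Prop :=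
  forall H : algebra, heyting H ->
  forall v : Fm -> sharp H, homomorphism Fm (sharp H) v ->
  (forall phi, In formula Sigma phi -> In (sharp H) (designated H) (v phi)) ->
  In (sharp H) (designated H) (v alpha).

(* Main.v *)
Require Import Defs.
From Stdlib Require Import List Wf_nat Ensembles.

(** Every axiom holds in every Heyting algebra, hence takes the value [1] or
    [omega] in its sharp.  For the rule, a value [omega] of the conclusion is
    already designated; otherwise the inclusion of variables forces both premises
    to take values in the Heyting algebra, where modus ponens is sound. *)

Section Heyting.

Variables (H : algebra) (HH : heyting H).
Implicit Types x y z : H.

Lemma meet_idem x : meet x x = x.
(* The second argument of [meet] is expanded to [join x (meet x x)], so one absorption law undoes
   the other. *)
Proof. rewrite <- (joinKmeet H HH x x) at 2. now apply meetKjoin. Qed.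

Lemma le_trans x y z : le x y -> le y z -> le x z.
Proof.
  unfold le. intros Hxy Hyz.
  now rewrite <- Hxy, <- meetA, Hyz.
Qed.

Lemma le_meet_l x y : le (meet x y) x.
Proof.
  unfold le.
  now rewrite (meetC H HH x y), <- meetA, meet_idem.
Qed.

Lemma le_meet_r x y : le (meet x y) y.
Proof. unfold le. now rewrite <- meetA, meet_idem. Qed.

Lemma le_meet x y z : le z x -> le z y -> le z (meet x y).
Proof. unfold le. intros Hx Hy. now rewrite meetA, Hx, Hy. Qed.

Lemma le_join_l x y : le x (join x y).
Proof. now apply meetKjoin. Qed.

Lemma le_join_r x y : le y (join x y).
Proof. rewrite joinC by assumption. apply le_join_l. Qed.

Lemma le_joinE x y : le x y -> join x y = y.
Proof.
  unfold le. intros <-.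
  now rewrite meetC, joinC, joinKmeet.
Qed.

Lemma join_le x y z : le x z -> le y z -> le (join x y) z.
Proof.
  intros Hx Hy.
  (* The bound [z] becomes [join x (join y z)], which reassociates to [join (join x y) z]. *)
  rewrite <- (le_joinE x z Hx), <- (le_joinE y z Hy), joinA by assumption.
  apply le_join_l.
Qed.

Lemma le_imp_intro x y z : le (meet x y) z -> le x (imp y z).
Proof. apply (residuation H HH). Qed.

(** Modus ponens inside a context [x]: the second premise makes [x] lie below [meet x y], and
    residuation handles the rest. *)
Lemma le_imp_elim x y z : le x (imp y z) -> le x y -> le x z.
Proof.
  intros Hi Hy. apply (residuation H HH) in Hi.
  apply le_trans with (meet x y); [|exact Hi].
  apply le_meet; [apply meet_idem|exact Hy].
Qed.

(** Case analysis inside a context [t]. Residuation moves [t] to the right of the inequality, where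
    the least upper bound property of [join] applies; this avoids proving distributivity. *)
Lemma join_elim x y z t :
  le t (imp x z) -> le t (imp y z) -> le t (join x y) -> le t z.
Proof.
  intros Hx Hy Ht.
  assert (Hj : le (join x y) (imp t z)).
  { apply join_le; apply le_imp_intro; rewrite meetC by assumption;
      now apply (residuation H HH). }
  apply le_imp_elim with t; [|apply meet_idem].
  now apply le_trans with (join x y).
Qed.

Lemma one_le_eq x : le one x -> x = one.
Proof.
  intros Hx. rewrite <- (le_one H HH x), meetC by assumption. exact Hx.
Qed.

Lemma imp_one_eq x : imp one x = one -> x = one.
Proof.
  intros Hx. apply one_le_eq, le_imp_elim with one; [|apply meet_idem].
  rewrite Hx. apply meet_idem.
Qed.

End Heyting.

Section Valuation.

Variables (H : algebra) (HH : heyting H) (v : Fm -> sharp H).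
Hypothesis Hv : homomorphism Fm (sharp H) v.

(** Restatement in terms of the constructors of [formula], which [rewrite] does
    not see through the projections of [Fm]. *)
Lemma hom_formula :
  (forall a b, v (And a b) = lift2 meet (v a) (v b)) /\
  (forall a b, v (Or a b) = lift2 join (v a) (v b)) /\
  (forall a b, v (Imp a b) = lift2 imp (v a) (v b)) /\
  (forall a, v (Neg a) = lift1 neg (v a)) /\
  v Zero = Some zero /\ v One = Some one.
Proof. destruct Hv; repeat split; assumption. Qed.

Lemma designatedE (x : sharp H) :
  In (sharp H) (designated H) x <-> x = None \/ x = Some one.
Proof.
  split.
  - intros []; [now right|now left].
  - intros [->| ->]; constructor.
Qed.

(** The value omega is absorbing, so it propagates from a variable up to every formula containing
    it. *)
Lemma var_omega (a : formula) (x : nat) :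
  In nat (var a) x -> v (Var x) = None -> v a = None.
Proof.
  destruct hom_formula as (HA & HO & HI & HN & _).
  intros Hx Ex. revert Hx.
  induction a as [y|a IHa b IHb|a IHa b IHb|a IHa b IHb|a IHa| |];
    simpl; intros Hx.
  - now destruct Hx.
  - rewrite HA. destruct Hx as [x Hx|x Hx];
      [rewrite IHa|rewrite IHb]; try assumption; now destruct (v a).
  - rewrite HO. destruct Hx as [x Hx|x Hx];
      [rewrite IHa|rewrite IHb]; try assumption; now destruct (v a).
  - rewrite HI. destruct Hx as [x Hx|x Hx];
      [rewrite IHa|rewrite IHb]; try assumption; now destruct (v a).
  - now rewrite HN, IHa.
  - destruct Hx.
  - destruct Hx.
Qed.

(** Operations on arguments from [H] stay in [H], and so do the constants; hence omega can only
    originate in a variable. *)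
Lemma omega_var (a : formula) :
  v a = None -> exists x, In nat (var a) x /\ v (Var x) = None.
Proof.
  destruct hom_formula as (HA & HO & HI & HN & HZ & HU).
  induction a as [y|a IHa b IHb|a IHa b IHb|a IHa b IHb|a IHa| |]; intros E.
  - exists y. now split.
  - rewrite HA in E. destruct (v a).
    + destruct (v b); [discriminate|].
      destruct (IHb eq_refl) as (x & Hx & Ex). exists x. split; [now right|easy].
    + destruct (IHa eq_refl) as (x & Hx & Ex). exists x. split; [now left|easy].
  - rewrite HO in E. destruct (v a).
    + destruct (v b); [discriminate|].
      destruct (IHb eq_refl) as (x & Hx & Ex). exists x. split; [now right|easy].
    + destruct (IHa eq_refl) as (x & Hx & Ex). exists x. split; [now left|easy].
  - rewrite HI in E. destruct (v a).
    + destruct (v b); [discriminate|].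
      destruct (IHb eq_refl) as (x & Hx & Ex). exists x. split; [now right|easy].
    + destruct (IHa eq_refl) as (x & Hx & Ex). exists x. split; [now left|easy].
  - rewrite HN in E. destruct (v a); [discriminate|]. now apply IHa.
  - rewrite HZ in E. discriminate.
  - rewrite HU in E. discriminate.
Qed.

Lemma axiom_designated (phi : formula) :
  HIPWK_axiom phi -> In (sharp H) (designated H) (v phi).
Proof.
  destruct hom_formula as (HA & HO & HI & HN & HZ & _).
  pose proof (meet_idem H HH) as refl.
  pose proof (le_meet_l H HH) as ml. pose proof (le_meet_r H HH) as mr.
  pose proof (le_trans H HH) as tr.
  intros Hphi. apply designatedE.
  (* If some component takes the value omega, so does the axiom. Otherwise the outer implications
     are moved to the left, leaving an entailment whose context is the meet of their antecedents. *)
  destruct Hphi; rewrite ?HI, ?HA, ?HO, ?HN, ?HZ, ?HI, ?HA, ?HO, ?HN;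
    try destruct (v a) as [x|]; try destruct (v b) as [y|];
    try destruct (v c) as [z|]; simpl; try (now left);
    right; f_equal; apply (one_le_eq H HH); rewrite ?(negE H HH);
    repeat apply (le_imp_intro H HH).
  - eauto.
  - apply (le_imp_elim H HH) with y; apply (le_imp_elim H HH) with x; eauto.
  - apply (le_meet H HH); eauto.
  - eauto.
  - eauto.
  - apply tr with x; [apply mr|apply (le_join_l H HH)].
  - apply tr with y; [apply mr|apply (le_join_r H HH)].
  - apply (join_elim H HH) with x y; eauto.
  - apply (le_imp_elim H HH) with y; apply (le_imp_elim H HH) with x; eauto.
  - apply tr with zero; [apply mr|apply (le_zero H HH)].
Qed.

Lemma rule_designated (a b phi : formula) :
  HIPWK_rule a b phi ->
  In (sharp H) (designated H) (v a) -> In (sharp H) (designated H) (v b) ->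
  In (sharp H) (designated H) (v phi).
Proof.
  intros [-> Hvar]. rewrite !designatedE.
  destruct hom_formula as (_ & _ & HI & _). rewrite HI.
  intros [Ea|Ea] Eb.
  (* The variable responsible for omega in [a] also occurs in [phi]. *)
  - left. destruct (omega_var a Ea) as (x & Hx & Ex).
    apply var_omega with x; [now apply Hvar|exact Ex].
  - rewrite Ea in Eb. destruct (v phi) as [y|]; [|now left].
    right. destruct Eb as [Eb|Eb]; [discriminate|].
    injection Eb as Eb. f_equal. now apply (imp_one_eq H HH).
Qed.

Lemma derivation_designated (Sigma : Ensemble formula) (s : list formula) :
  (forall phi, In formula Sigma phi -> In (sharp H) (designated H) (v phi)) ->
  HIPWK_derivation Sigma s ->
  forall n phi, nth_error s n = Some phi ->
  In (sharp H) (designated H) (v phi).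
Proof.
  (* Strong induction, because the premises of a rule may stand at any earlier positions. *)
  intros HS Hs n. induction n as [n IH] using lt_wf_ind. intros phi Hn.
  destruct (Hs n phi Hn)
    as [Hax|[Hin|(i & j & a & b & Hi & Hj & Ei & Ej & Hr)]].
  - now apply axiom_designated.
  - now apply HS.
  - apply rule_designated with a b; eauto.
Qed.

End Valuation.

Theorem theorem4p11 : forall (Sigma : Ensemble formula) (alpha : formula),
  HIPWK_derives Sigma alpha -> IPWK_entails Sigma alpha.
Proof.
  intros Sigma alpha [s Hs] H HH v Hv HS.
  (* Counting from 0, [alpha] stands at position [length s] of [s ++ [alpha]]. *)
  apply (derivation_designated H HH v Hv Sigma _ HS Hs (length s)).
  now rewrite nth_error_app2, PeanoNat.Nat.sub_diag.
Qed.
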